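(* Consider $\ddot x=-\nabla\phi(x)$, $x\in\mathbf{R}^{N}$, and a splitting $\phi=\sum_{i=1}^{N}\phi^{[i]}$. Let $$\mathbb{L}^{\text{1st}}(x_n,x_{n+1},h)=\frac12\frac{(x_{n+1}-x_n)^\top(x_{n+1}-x_n)}{h^2}-\sum_{i=1}^{N}\phi^{[i]}(\widehat x_n^{\,i}),\qquad \widehat x_n^{\,i}=x_n+\sum_{j=1}^{i}(x_{n+1}^j-x_n^j)\mathbf{e}_j,$$ let $\mathbb{L}^*(x_n,x_{n+1},h)=\mathbb{L}^{\text{1st}}(x_{n+1},x_n,-h)$ be its adjoint, and let $\Phi_h=\Phi^h_{H_N}\circ\cdots\circ\Phi^h_{H_1}$, where $\Phi^h_{H_i}:(x_n,p_n)\mapsto(x_{n+1},p_{n+1})$ is given by $x_{n+1}=x_n+hp_n^i\mathbf{e}_i$, $p_{n+1}=p_n-h\nabla\phi^{[i]}(x_{n+1})$. Then: (1) the variational integrator derived from $\mathbb{L}^*$ is equivalent to the adjoint method $\Phi_h^*$ of $\Phi_h$; (2) the variational integrator derived from $$\mathbb{L}^{\text{2nd}}(x_n,x_{n+1},h)=\tfrac12\mathbb{L}^{\text{1st}}(x_n,x_{n+1/2},h/2)+\tfrac12\mathbb{L}^*(x_{n+1/2},x_{n+1},h/2)$$ is equivalent to $\Phi_{h/2}^*\circ\Phi_{h/2}$; (3) the variational integrator derived from $$\mathbb{L}^{\text{2nd}}(x_n,x_{n+1},h)=\tfrac12\mathbb{L}^*(x_n,x_{n+1/2},h/2)+\tfrac12\mathbb{L}^{\text{1st}}(x_{n+1/2},x_{n+1},h/2)$$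 is equivalent to $\Phi_{h/2}\circ\Phi_{h/2}^*$.
   Context: Functions $\phi^{[i]}$ are smooth. Subscripts on points denote the time index, superscripts components; $\mathbf{e}_j$ is the $j$-th standard basis vector. The adjoint of a one-step method $\Phi_h$ is $\Phi_h^*=(\Phi_{-h})^{-1}$. For a discrete Lagrangian $\mathbb{L}$, the variational integrator consists of the discrete Euler–Lagrange equations $\partial_1\mathbb{L}(x_n,x_{n+1},h)+\partial_2\mathbb{L}(x_{n-1},x_n,h)=0$, i.e. stationarity of $h\sum_n\mathbb{L}(x_n,x_{n+1},h)$. The discrete Legendre transforms define momenta $p_n=-h\,\partial\mathbb{L}(x_n,x_{n+1},h)/\partial x_n$ and $p_{n+1}=h\,\partial\mathbb{L}(x_n,x_{n+1},h)/\partial x_{n+1}$. The integrator is equivalent to a one-step map $\Psi_h$ if these relations define precisely $(x_n,p_n)\mapsto(x_{n+1},p_{n+1})=\Psi_h(x_n,p_n)$. For the two-stage discrete Lagrangians in (2), (3), the intermediate point $x_{n+1/2}$ is also a variable of the action, so the discrete Euler–Lagrange equations include stationarity with respect to $x_{n+1/2}$: the partial derivative of $\mathbb{L}^{\text{2nd}}$ with respect to $x_{n+1/2}$ vanishes; the partial derivatives with respect to $x_n$ and $x_{n+1}$ defining $p_n,p_{n+1}$ are taken with $x_{n+1/2}$ held fixed. *)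

(* Defs.v *)
From HB Require Import structures.
From mathcomp Require Import all_boot all_order all_algebra.
From mathcomp Require Import all_classical all_reals all_analysis.

Set Implicit Arguments.
Unset Strict Implicit.
Unset Printing Implicit Defensive.
Import Order.TTheory GRing.Theory Num.Theory.
Import numFieldNormedType.Exports.
Local Open Scope ring_scope.

Section Calculus.
Context {R : realType} {N : nat}.
Implicit Types f : 'cV[R]_N -> R.

Definition basis_vec (j : 'I_N) : 'cV[R]_N := delta_mx j 0.

Definition partial (j : 'I_N) f : 'cV[R]_N -> R :=
  fun x => 'D_(basis_vec j) f x.

Definition grad f (x : 'cV[R]_N) : 'cV[R]_N := \col_j partial j f x.

(* C^oo: every iterated partial derivative (f itself for s = [::]) is
   differentiable, hence in particular continuous. *)
Definition smooth f : Prop :=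
  forall (s : seq 'I_N) x, differentiable (foldr partial f s) x.

End Calculus.

Section OneStepMethods.
Context {R : realType}.

(* [pinv setT F] is the total function sending y to a preimage of y under F
   (when there is one); it is the inverse of F as soon as F is bijective. *)
Definition adjoint (T : pointedType) (Phi : R -> T -> T) (h : R) : T -> T :=
  pinv setT (Phi (- h)).

Lemma adjointK (T : pointedType) (Phi : R -> T -> T) (h : R) :
  bijective (Phi (- h)) ->
  cancel (Phi (- h)) (adjoint Phi h) /\ cancel (adjoint Phi h) (Phi (- h)).
Proof.
move=> [g fK gK]; split=> z.
- rewrite /adjoint pinvKV ?inE //.
  by move=> a b _ _; apply: (can_inj fK).
- by rewrite /adjoint pinvK // inE; exists (g z).
Qed.

End OneStepMethods.

Section SplitSymplecticEuler.
Context {R : realType} {N : nat}.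
Local Notation V := 'cV[R]_N.
Variable phis : 'I_N -> V -> R.

(* States are pairs (x, p). *)
Definition PhiH (i : 'I_N) (h : R) (z : V * V) : V * V :=
  let x' := z.1 + (h * z.2 i 0) *: basis_vec i in
  (x', z.2 - h *: grad (phis i) x').

(* foldl over [:: i_1; ...; i_N] applies PhiH i_1 first and PhiH i_N last. *)
Definition PhiSplit (h : R) (z : V * V) : V * V :=
  foldl (fun w i => PhiH i h w) z (enum 'I_N).

Lemma PhiH_bij (i : 'I_N) (h : R) : bijective (PhiH i h).
Proof.
exists (fun w : V * V => let p := w.2 + h *: grad (phis i) w.1 in
          (w.1 - (h * p i 0) *: basis_vec i, p)) => [[x p]|[x p]];
  by rewrite /PhiH /= ?(subrK, addrK).
Qed.

Lemma PhiSplit_bij (h : R) : bijective (PhiSplit h).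
Proof.
suff H s : bijective (fun z : V * V => foldl (fun w i => PhiH i h w) z s).
  exact: H.
elim: s => [|i s IH] /=; first by exists id.
exact: (bij_comp IH (PhiH_bij i h)).
Qed.

End SplitSymplecticEuler.

Section DiscreteMechanics.
Context {R : realType} {N : nat}.
Local Notation V := 'cV[R]_N.
Local Notation lagrangian1 := (V -> V -> R -> R).
Local Notation lagrangian2 := (V -> V -> V -> R -> R).
Implicit Types (L : lagrangian1) (LL : lagrangian2).

Definition xhat (x x' : V) (i : 'I_N) : V :=
  x + \sum_(j < N | (j <= i)%N) (x' j 0 - x j 0) *: basis_vec j.

Definition L1st (phis : 'I_N -> V -> R) (x x' : V) (h : R) : R :=
  2^-1 * (((x' - x)^T *m (x' - x)) 0 0 / h ^+ 2)
  - \sum_(i < N) phis i (xhat x x' i).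

Definition Ladj L (x x' : V) (h : R) : R := L x' x (- h).

Definition two_stage (La Lb : lagrangian1) (x y x' : V) (h : R) : R :=
  2^-1 * La x y (h / 2) + 2^-1 * Lb y x' (h / 2).

Definition d1 L (x x' : V) (h : R) : V := grad (fun u => L u x' h) x.
Definition d2 L (x x' : V) (h : R) : V := grad (fun u => L x u h) x'.

Definition d_start LL (x y x' : V) (h : R) : V := grad (fun u => LL u y x' h) x.
Definition d_mid LL (x y x' : V) (h : R) : V := grad (fun u => LL x u x' h) y.
Definition d_end LL (x y x' : V) (h : R) : V := grad (fun u => LL x y u h) x'.

(* Discrete Euler-Lagrange equations for x_0, ..., x_K (interior points only:
   the end points of the discrete action are held fixed). *)
Definition discrete_EL L (h : R) (K : nat) (x : nat -> V) : Prop :=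
  forall n, (n.+1 < K)%N ->
    d1 L (x n.+1) (x n.+2) h + d2 L (x n) (x n.+1) h = 0.

(* The same when the action also depends on the intermediate points
   y_n = x_{n+1/2}, 0 <= n < K. *)
Definition discrete_EL2 LL (h : R) (K : nat) (x y : nat -> V) : Prop :=
  (forall n, (n < K)%N -> d_mid LL (x n) (y n) (x n.+1) h = 0) /\
  (forall n, (n.+1 < K)%N ->
     d_start LL (x n.+1) (y n.+1) (x n.+2) h
     + d_end LL (x n) (y n) (x n.+1) h = 0).

Definition legendre L (h : R) (x p x' p' : V) : Prop :=
  p = - (h *: d1 L x x' h) /\ p' = h *: d2 L x x' h.

Definition legendre2 LL (h : R) (x p y x' p' : V) : Prop :=
  [/\ d_mid LL x y x' h = 0,
      p = - (h *: d_start LL x y x' h) &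
      p' = h *: d_end LL x y x' h].

Definition orbit_segment (Psi : V * V -> V * V) (K : nat) (x p : nat -> V) :=
  forall n, (n < K)%N -> (x n.+1, p n.+1) = Psi (x n, p n).

(* First clause: the momentum relations are exactly the graph of Psi.  Second
   clause: the solutions of the discrete Euler-Lagrange equations are exactly
   the position parts of the orbits of Psi. *)
Definition VI_equivalent L (h : R) (Psi : V * V -> V * V) : Prop :=
  (forall x p x' p', legendre L h x p x' p' <-> (x', p') = Psi (x, p)) /\
  (forall K x, discrete_EL L h K x <-> exists p, orbit_segment Psi K x p).

Definition VI2_equivalent LL (h : R) (Psi : V * V -> V * V) : Prop :=
  (forall x p x' p',
     (exists y, legendre2 LL h x p y x' p') <-> (x', p') = Psi (x, p)) /\
  (forall K x,
     (exists y, discrete_EL2 LL h K x y) <-> exists p, orbit_segment Psi K x p).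

End DiscreteMechanics.

(* Main.v *)
Require Import Defs.
From mathcomp Require Import all_boot all_order all_algebra.
From mathcomp Require Import all_classical all_reals all_analysis.
From mathcomp Require Import ring.
Import Order.TTheory GRing.Theory Num.Theory.
Import numFieldNormedType.Exports.
Local Open Scope classical_set_scope.
Local Open Scope ring_scope.

(** For the discrete Lagrangian L1st, the points xhat^i lie on the staircase
    that leads from x to x' by changing the coordinates one at a time, in
    increasing order.  Differentiating along e_a, the potential phi^[i] sees
    the a-th coordinate of x' if a <= i and that of x if i < a.  Solved for x',
    the momentum relations therefore read

      x'^a = x^a + h (p^a - h sum_(i < a) d_a phi^[i](xhat^i)),
      p'   = p - h sum_i grad phi^[i](xhat^i).

    The first line is triangular: its right-hand side involves only the
    coordinates x'^b with b < a, so that (x, p) determines (x', p').  But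
    running the maps Phi_(H_1), ..., Phi_(H_N) in turn does precisely this
    substitution: the step i moves coordinate i only, hence the positions
    visited are the xhat^i, and when the step a is taken the momentum has been
    kicked by the grad phi^[i](xhat^i) with i < a.  So the relations of L1st
    are the graph of Phi_h ([generates_L1st]), for h of either sign.

    The three claims are formal consequences.  Exchanging the end points and
    changing the sign of h exchanges the two momentum relations, so the adjoint
    Lagrangian generates the inverse of Phi_(-h) ([generates_adjoint]).  For a
    two-stage Lagrangian, stationarity at the intermediate point says that the
    final momentum of the first half step is the initial momentum of the
    second one, so the relations compose ([generates_two_stage]).  Finally,
    whenever the momentum relations are the graph of a map, the discrete
    Euler-Lagrange equations say that the momentum with which a step arrives
    at a point is the one with which the next step leaves it, hence that the
    steps fit together into an orbit ([EL_orbit]). *)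

(** * Partial derivatives *)

Section PartialDerivatives.
Context {R : realType} {N : nat}.
Local Notation V := 'cV[R]_N.

(** A directional derivative depends only on the restriction to a line, so it
    can be transported between two functions that agree along lines.  This
    replaces the chain rule for the staircase points, including the case
    [v = 0] where the motion of the argument is killed. *)
Lemma is_derive_same_line (f g : V -> R) (x y v w : V) (df : R) :
  (forall t, g (t *: w + y) = f (t *: v + x)) ->
  is_derive x v f df -> is_derive y w g df.
Proof.
move=> fg.
have E : (fun t : R => t^-1 *: ((g \o shift y) (t *: w) - g y)) =
         (fun t : R => t^-1 *: ((f \o shift x) (t *: v) - f x)).
  have := fg 0; rewrite !scale0r !add0r => fg0.
  by apply/funext => t /=; rewrite fg fg0.
by move=> [fx <-]; split; rewrite /derivable /derive E.
Qed.

Lemma is_derive_quadratic (f : V -> R) (x v : V) (A B : R) :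
  (forall t, f (t *: v + x) - f x = t * (A + t * B)) -> is_derive x v f A.
Proof.
move=> fx.
suff: (fun t : R => t^-1 *: ((f \o shift x) (t *: v) - f x)) @ 0^' --> A.
  by move=> c; split; [apply: cvgP c | apply: cvg_lim c].
have c : (fun t : R => A + t * B) @ 0^' --> A.
  apply: cvg_within_filter.
  have : A + 0 * B = A by rewrite mul0r addr0.
  move=> {2}<-; apply: cvgD; first exact: cvg_cst.
  by apply: cvgM; [exact: cvg_id | exact: cvg_cst].
apply: cvg_trans c; apply: near_eq_cvg.
near=> t.
have t0 : t != 0 by near: t; exact: nbhs_dnbhs_neq.
by rewrite /= fx /GRing.scale /= mulKf.
Unshelve. all: by end_near.
Qed.

Definition sqnorm (u : V) : R := (u^T *m u) 0 0.

Lemma sqnormE (u : V) : sqnorm u = \sum_k u k 0 ^+ 2.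
Proof. by rewrite /sqnorm mxE; apply: eq_bigr => k _; rewrite mxE expr2. Qed.

Lemma sqnormN (u : V) : sqnorm (- u) = sqnorm u.
Proof. by rewrite !sqnormE; apply: eq_bigr => k _; rewrite mxE sqrrN. Qed.

Lemma is_derive_sqnorm (a : 'I_N) (c u : V) :
  is_derive u (basis_vec a) (fun w => sqnorm (w - c)) (2 * (u - c) a 0).
Proof.
apply: (@is_derive_quadratic _ _ _ _ 1) => t.
rewrite -addrA; set d := u - c.
rewrite !sqnormE !(bigD1 (P := xpredT) a) //=.
rewrite (eq_bigr (fun k => d k 0 ^+ 2)) => [|k /negPf ka]; last first.
  by rewrite !mxE ka mulr0 add0r.
rewrite !mxE !eqxx /=; ring.
Qed.

Lemma grad_lincomb (k l : R) (f g : V -> R) (x : V) :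
  (forall a, derivable f x (basis_vec a)) ->
  (forall a, derivable g x (basis_vec a)) ->
  grad (fun u => k * f u + l * g u) x = k *: grad f x + l *: grad g x.
Proof.
move=> df dg; apply/colP => a; rewrite !mxE /partial.
have -> : (fun u => k * f u + l * g u) = k \*: f + l \*: g by [].
by rewrite deriveD ?deriveZ //; exact: derivableZ.
Qed.

Lemma grad_cst (c : R) (x : V) : grad (fun=> c) x = 0.
Proof. by apply/colP => a; rewrite !mxE /partial derive_cst. Qed.

End PartialDerivatives.

(** * Momentum relations and one-step maps *)

Section MomentumRelations.
Context {R : realType} {N : nat}.
Local Notation V := 'cV[R]_N.

Definition generates (L : V -> V -> R -> R) (h : R) (Psi : V * V -> V * V) :=
  forall x p x' p', legendre L h x p x' p' <-> (x', p') = Psi (x, p).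

(** The partial derivatives of [Ladj L] at (x, x') are those of [L] at (x', x)
    in the other order; with -h for h, the outgoing momentum of one
    Lagrangian is the incoming momentum of the other. *)
Lemma generates_adjoint (L : V -> V -> R -> R) (Phi : R -> V * V -> V * V)
    (h : R) : bijective (Phi (- h)) ->
  generates L (- h) (Phi (- h)) -> generates (Ladj L) h (adjoint Phi h).
Proof.
move=> /adjointK[PhiK adjK] genL x p x' p'.
have -> : legendre (Ladj L) h x p x' p' <-> legendre L (- h) x' p' x p.
  by rewrite /legendre !scaleNr opprK; split=> -[-> ->].
by rewrite genL; split=> ->; rewrite ?PhiK ?adjK.
Qed.

Definition partially_derivable (L : V -> V -> R -> R) (h : R) : Prop :=
  forall x x' a, derivable (fun u => L u x' h) x (basis_vec a) /\
                 derivable (fun u => L x u h) x' (basis_vec a).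

(** The momentum q at the intermediate point is produced by the first half
    and consumed by the second; the equation of stationarity in y is the
    equality of these two values.  The factors 1/2 turn h into the half step. *)
Lemma legendre2_two_stage (La Lb : V -> V -> R -> R) (h : R)
    (x p y x' p' : V) : h != 0 ->
  partially_derivable La (h / 2) -> partially_derivable Lb (h / 2) ->
  legendre2 (two_stage La Lb) h x p y x' p' <->
  exists q, legendre La (h / 2) x p y q /\ legendre Lb (h / 2) y q x' p'.
Proof.
move=> h0 dLa dLb; rewrite /legendre2 /legendre.
have dcst (c : R) u (a : 'I_N) : derivable (fun=> c) u (basis_vec a).
  exact: derivable_cst.
have -> : d_mid (two_stage La Lb) x y x' h =
    2^-1 *: d2 La x y (h / 2) + 2^-1 *: d1 Lb y x' (h / 2).
  apply: grad_lincomb => a; [exact: (proj2 (dLa x y a))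
                            | exact: (proj1 (dLb y x' a))].
have -> : d_start (two_stage La Lb) x y x' h = 2^-1 *: d1 La x y (h / 2).
  rewrite /d_start /two_stage grad_lincomb ?grad_cst ?scaler0 ?addr0 // => a.
  exact: (proj1 (dLa x y a)).
have -> : d_end (two_stage La Lb) x y x' h = 2^-1 *: d2 Lb y x' (h / 2).
  rewrite /d_end /two_stage grad_lincomb ?grad_cst ?scaler0 ?add0r // => a.
  exact: (proj2 (dLb y x' a)).
rewrite !scalerA; split=> [[mid -> ->]|[q [[-> qE] [qE' ->]]]].
  exists ((h / 2) *: d2 La x y (h / 2)); do 2!split=> //.
  apply/eqP; rewrite -addr_eq0 -!scalerA -scalerDr.
  by rewrite mid scaler0.
split=> //; apply: (scalerI h0); rewrite scaler0 scalerDr !scalerA -qE qE'.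
by rewrite addNr.
Qed.

Lemma generates_two_stage (La Lb : V -> V -> R -> R)
    (Psia Psib : V * V -> V * V) (h : R) : h != 0 ->
  partially_derivable La (h / 2) -> partially_derivable Lb (h / 2) ->
  generates La (h / 2) Psia -> generates Lb (h / 2) Psib ->
  forall x p x' p',
    (exists y, legendre2 (two_stage La Lb) h x p y x' p') <->
    (x', p') = (Psib \o Psia) (x, p).
Proof.
move=> h0 dLa dLb genLa genLb x p x' p'; split=> [[y]|].
  by rewrite legendre2_two_stage // => -[q [/genLa Ea /genLb]];
    rewrite /= -Ea.
rewrite /=; case E: (Psia _) => [y q] /genLb Lbq.
by exists y; rewrite legendre2_two_stage //; exists q; split=> //; apply/genLa.
Qed.

(** The passage from one step to a trajectory, for one- and two-stage
    Lagrangians at once: [w] carries the internal variables of a step, [C] their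
    stationarity, and [A], [B] are the derivatives at the two end points. *)
Lemma EL_orbit (W : Type) (w0 : W) (C : V -> W -> V -> Prop)
    (A B : V -> W -> V -> V) (h : R) (Psi : V * V -> V * V)
    (K : nat) (x : nat -> V) : h != 0 ->
  (forall x p x' p',
     (exists w, [/\ C x w x', p = - (h *: A x w x') & p' = h *: B x w x']) <->
     (x', p') = Psi (x, p)) ->
  (exists w : nat -> W,
     (forall n, (n < K)%N -> C (x n) (w n) (x n.+1)) /\
     (forall n, (n.+1 < K)%N ->
        A (x n.+1) (w n.+1) (x n.+2) + B (x n) (w n) (x n.+1) = 0)) <->
  exists p, orbit_segment Psi K x p.
Proof.
move=> h0 PsiE; split=> [[w [Cw EL]]|[p orb]].
  (* Each momentum is read off the step that leaves the point, except at the
     last point, where only the arriving step exists. *)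
  exists (fun n => if (n < K)%N then - (h *: A (x n) (w n) (x n.+1))
                   else h *: B (x n.-1) (w n.-1) (x n)) => n nK.
  apply/PsiE; exists (w n); split; rewrite ?nK //; first exact: Cw.
  case: ifP => // nK1; apply/eqP; rewrite eq_sym -addr_eq0 -scalerDr.
  by rewrite addrC EL ?scaler0.
have /boolp.choice[w wP] n : exists w, (n < K)%N ->
    [/\ C (x n) w (x n.+1), p n = - (h *: A (x n) w (x n.+1)) &
        p n.+1 = h *: B (x n) w (x n.+1)].
  case: ltnP => nK; last by exists w0.
  by have /PsiE[w ?] := orb n nK; exists w.
exists w; split=> n nK; first by have [] := wP n nK.
have [_ pE _] := wP n.+1 nK; have [_ _ pE'] := wP n (ltnW nK).
apply: (scalerI h0); rewrite scalerDr scaler0 -pE' pE.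
by rewrite addrN.
Qed.

Lemma generates_VI (L : V -> V -> R -> R) (h : R) (Psi : V * V -> V * V) :
  h != 0 -> generates L h Psi -> VI_equivalent L h Psi.
Proof.
move=> h0 genL; split=> // K x.
rewrite -(@EL_orbit unit tt (fun _ _ _ => True) (fun u _ u' => d1 L u u' h)
                    (fun u _ u' => d2 L u u' h) h Psi K x h0).
  by split=> [EL|[_ [_ EL]]] //; exists (fun=> tt).
move=> u p u' p'; rewrite -genL; split=> [[_ [_ -> ->]]|[-> ->]].
  by [].
by exists tt.
Qed.

Lemma generates_VI2 (LL : V -> V -> V -> R -> R) (h : R)
    (Psi : V * V -> V * V) : h != 0 ->
  (forall x p x' p',
     (exists y, legendre2 LL h x p y x' p') <-> (x', p') = Psi (x, p)) ->
  VI2_equivalent LL h Psi.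
Proof.
move=> h0 genLL; split=> // K x.
exact: (@EL_orbit V 0 (fun u y u' => d_mid LL u y u' h = 0)
  (fun u y u' => d_start LL u y u' h) (fun u y u' => d_end LL u y u' h)
  h Psi K x h0 genLL).
Qed.

End MomentumRelations.

(** * The split Lagrangian *)

Section SplitLagrangian.
Context {R : realType} {N : nat}.
Local Notation V := 'cV[R]_N.
Variable phis : 'I_N -> V -> R.
Hypothesis phis_smooth : forall i, smooth (phis i).

Lemma xhatE (x x' : V) (i a : 'I_N) :
  xhat x x' i a 0 = if (a <= i)%N then x' a 0 else x a 0.
Proof.
rewrite /xhat mxE summxE; case: ifP => ai; last first.
  rewrite big1 ?addr0 // => j ji; rewrite !mxE.
  by case: eqP => [aj|_]; [rewrite -aj ai in ji | rewrite mulr0].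
rewrite (bigD1 a) //= big1 => [|j /andP[_ /negPf ja]].
  by rewrite !mxE !eqxx mulr1 addr0 subrKC.
by rewrite !mxE eq_sym ja mulr0.
Qed.

Lemma is_derive_phis (i a : 'I_N) (y : V) :
  is_derive y (basis_vec a) (phis i) (partial a (phis i) y).
Proof. exact/derivableP/diff_derivable/(phis_smooth i [::]). Qed.

Lemma is_derive_L1st_end (x x' : V) (h : R) (a : 'I_N) :
  is_derive x' (basis_vec a) (fun u => L1st phis x u h)
    ((x' a 0 - x a 0) / h ^+ 2
     - \sum_(i < N | (a <= i)%N) partial a (phis i) (xhat x x' i)).
Proof.
have -> : (fun u => L1st phis x u h) =
    (2^-1 / h ^+ 2) \*: (fun u => sqnorm (u - x))
    - \sum_(i < N) (fun u => phis i (xhat x u i)).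
  apply/funext => u; rewrite /L1st fctE /= fct_sumE; congr (_ - _).
  by rewrite /GRing.scale /= mulrA mulrAC.
have dsq := is_derive_sqnorm a x x'.
have dphi i : is_derive x' (basis_vec a) (fun u => phis i (xhat x u i))
    (if (a <= i)%N then partial a (phis i) (xhat x x' i) else 0).
  case: ifP => ai.
    apply: is_derive_same_line (is_derive_phis i a (xhat x x' i)) => t.
    congr phis; apply/colP => b; rewrite xhatE [RHS]mxE xhatE !mxE.
    case: ifP => // bi; case: eqP => [ba|]; last by rewrite mulr0 add0r.
    by rewrite ba ai in bi.
  apply: is_derive_same_line (is_derive0 (phis i) (xhat x x' i)) => t.
  congr phis; apply/colP => b; rewrite scaler0 add0r !xhatE !mxE.
  case: ifP => // bi; case: eqP => [ba|]; last by rewrite mulr0 add0r.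
  by rewrite ba ai in bi.
apply: is_derive_eq (is_deriveB (is_deriveZ _ dsq) (is_derive_sum dphi)) _.
rewrite [in RHS]big_mkcond /=; congr (_ - _).
by rewrite !mxE /GRing.scale /= mulrACA mulVf ?pnatr_eq0 // mul1r mulrC.
Qed.

Lemma is_derive_L1st_start (x x' : V) (h : R) (a : 'I_N) :
  is_derive x (basis_vec a) (fun u => L1st phis u x' h)
    (- ((x' a 0 - x a 0) / h ^+ 2)
     - \sum_(i < N | (i < a)%N) partial a (phis i) (xhat x x' i)).
Proof.
have -> : (fun u => L1st phis u x' h) =
    (2^-1 / h ^+ 2) \*: (fun u => sqnorm (u - x'))
    - \sum_(i < N) (fun u => phis i (xhat u x' i)).
  apply/funext => u; rewrite /L1st fctE /= fct_sumE; congr (_ - _).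
  by rewrite -sqnormN opprB /GRing.scale /= mulrA mulrAC.
have dsq := is_derive_sqnorm a x' x.
have dphi i : is_derive x (basis_vec a) (fun u => phis i (xhat u x' i))
    (if (i < a)%N then partial a (phis i) (xhat x x' i) else 0).
  rewrite ltnNge; case: ifP => /= ai.
    apply: is_derive_same_line (is_derive_phis i a (xhat x x' i)) => t.
    congr phis; apply/colP => b; rewrite xhatE [RHS]mxE xhatE !mxE.
    case: ifP => // bi; case: eqP => [ba|]; last by rewrite mulr0 add0r.
    by rewrite -ba bi in ai.
  apply: is_derive_same_line (is_derive0 (phis i) (xhat x x' i)) => t.
  congr phis; apply/colP => b; rewrite scaler0 add0r !xhatE !mxE.
  case: ifP => // bi; case: eqP => [ba|]; last by rewrite mulr0 add0r.
  by rewrite -ba bi in ai.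
apply: is_derive_eq (is_deriveB (is_deriveZ _ dsq) (is_derive_sum dphi)) _.
rewrite [in RHS]big_mkcond /=; congr (_ - _).
rewrite !mxE /GRing.scale /= mulrACA mulVf ?pnatr_eq0 // mul1r.
by rewrite -mulNr opprB mulrC.
Qed.

(** The momentum relations of [L1st], solved for the new state. *)
Definition momentum_system (h : R) (x p x' p' : V) : Prop :=
  (forall a, x' a 0 = x a 0 + h * (p a 0
     - h * \sum_(i < N | (i < a)%N) partial a (phis i) (xhat x x' i))) /\
  p' = p - h *: \sum_(i < N) grad (phis i) (xhat x x' i).

Lemma legendre_L1stE (h : R) (x p x' p' : V) : h != 0 ->
  legendre (L1st phis) h x p x' p' <-> momentum_system h x p x' p'.
Proof.
move=> h0; rewrite /legendre /momentum_system.
have d1E a : d1 (L1st phis) x x' h a 0 = - ((x' a 0 - x a 0) / h ^+ 2)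
     - \sum_(i < N | (i < a)%N) partial a (phis i) (xhat x x' i).
  by rewrite mxE; apply: derive_val; exact: is_derive_L1st_start.
have d2E a : d2 (L1st phis) x x' h a 0 = (x' a 0 - x a 0) / h ^+ 2
     - \sum_(i < N | (a <= i)%N) partial a (phis i) (xhat x x' i).
  by rewrite mxE; apply: derive_val; exact: is_derive_L1st_end.
have sumE a : (\sum_(i < N) grad (phis i) (xhat x x' i)) a 0 =
    \sum_(i < N | (i < a)%N) partial a (phis i) (xhat x x' i)
    + \sum_(i < N | (a <= i)%N) partial a (phis i) (xhat x x' i).
  rewrite summxE (bigID (fun i : 'I_N => (i < a)%N)) /=.
  by under [in X in _ + X]eq_bigl do rewrite -leqNgt;
    congr (_ + _); apply: eq_bigr => i _; rewrite mxE.
move: (d1 _ _ _ _) (d2 _ _ _ _) (\sum_(i < N) _) d1E d2E sumE.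
move=> D1 D2 S d1E d2E sumE.
split=> [[-> ->]|[xE ->]]; split.
- by move=> a; rewrite !mxE d1E; field.
- by apply/colP => a; rewrite !mxE d1E d2E sumE; field.
- by apply/colP => a; rewrite !mxE d1E {1}xE; field.
- by apply/colP => a; rewrite !mxE d2E sumE {1}xE; field.
Qed.

(** * The composition of the split flows *)

Definition stage (m : nat) (h : R) (z : V * V) : V * V :=
  foldl (fun w i => PhiH phis i h w) z (take m (enum 'I_N)).

Lemma stage_full (h : R) (z : V * V) : stage N h z = PhiSplit phis h z.
Proof. by rewrite /stage take_oversize // size_enum_ord. Qed.

Lemma stageS (i : 'I_N) (h : R) (z : V * V) :
  stage i.+1 h z = PhiH phis i h (stage i h z).
Proof.
rewrite /stage (take_nth i) ?size_enum_ord // nth_ord_enum.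
by rewrite -cats1 foldl_cat.
Qed.

Lemma stage_posS (i a : 'I_N) (h : R) (z : V * V) :
  (stage i.+1 h z).1 a 0 =
  (stage i h z).1 a 0 + (if a == i then h * (stage i h z).2 i 0 else 0).
Proof.
rewrite stageS /PhiH /= !mxE andbT.
by case: eqP => [->|_]; rewrite ?mulr1 ?mulr0.
Qed.

(** The stages m, ..., n.-1 change the coordinates with these indices only. *)
Lemma stage_pos_stable (m n : nat) (a : 'I_N) (h : R) (z : V * V) :
  (m <= n <= N)%N -> ((a < m) || (n <= a))%N ->
  (stage n h z).1 a 0 = (stage m h z).1 a 0.
Proof.
elim: n => [|n IHn] /andP[mn nN] out.
  by move: mn; rewrite leqn0 => /eqP ->.
move: mn; rewrite leq_eqVlt => /predU1P[-> //|mn].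
rewrite -[n]/(nat_of_ord (Ordinal nN)) stage_posS /= ifF ?addr0.
  apply: IHn; first by rewrite -ltnS mn ltnW.
  by case/orP: out => [->|/ltnW ->]; rewrite ?orbT.
apply/eqP => an; move: out; rewrite an /= ltnn orbF.
by rewrite ltnNge -ltnS mn.
Qed.

(** After the step [i], the coordinates up to [i] have their final values and
    the others their initial ones: this is the staircase point. *)
Lemma stage_pos (i : 'I_N) (h : R) (z : V * V) :
  (stage i.+1 h z).1 = xhat z.1 (stage N h z).1 i.
Proof.
apply/colP => a; rewrite xhatE; case: leqP => ai.
  by rewrite (@stage_pos_stable i.+1 N) ?ltnS ?ai ?ltn_ord ?leqnn.
by rewrite (@stage_pos_stable 0 i.+1) ?ai ?orbT ?ltn_ord // /stage take0.
Qed.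

Lemma stage_momS (i : 'I_N) (h : R) (z : V * V) :
  (stage i.+1 h z).2 =
  (stage i h z).2 - h *: grad (phis i) (stage i.+1 h z).1.
Proof. by rewrite stageS. Qed.

Lemma stage_mom (m : nat) (h : R) (z : V * V) : (m <= N)%N ->
  (stage m h z).2 = z.2 - h *: \sum_(i < N | (i < m)%N)
                               grad (phis i) (xhat z.1 (stage N h z).1 i).
Proof.
elim: m => [_|m IHm mN].
  by rewrite big_pred0 // scaler0 subr0 /stage take0.
have := stage_momS (Ordinal mN) h z; rewrite stage_pos /= => ->.
rewrite IHm ?(ltnW mN) // [in RHS](bigD1 (Ordinal mN)) ?ltnSn //=.
rewrite scalerDr opprD addrA addrAC.
congr (_ - _ *: _ - _ *: _).
apply: eq_bigl => i; rewrite ltnS ltn_neqAle andbC.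
by rewrite -val_eqE.
Qed.

(** The composition solves the system because of [stage_pos]; conversely the
    system has only one solution, by induction on the coordinate. *)
Lemma momentum_system_PhiSplit (h : R) (x p x' p' : V) :
  momentum_system h x p x' p' <-> (x', p') = PhiSplit phis h (x, p).
Proof.
have sysP : momentum_system h x p (PhiSplit phis h (x, p)).1
                                  (PhiSplit phis h (x, p)).2.
  rewrite -stage_full; split=> [a|]; last first.
    rewrite stage_mom //=; congr (_ - _ *: _).
    by apply: eq_bigl => i; rewrite ltn_ord.
  have aN : (a <= N)%N := ltnW (ltn_ord a).
  rewrite (@stage_pos_stable a.+1 N) ?ltnSn ?ltn_ord ?leqnn //.
  rewrite stage_posS eqxx (@stage_pos_stable 0 a) ?leqnn ?orbT ?aN //.
  rewrite {1}/stage take0 /= (@stage_mom a) //.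
  rewrite !mxE summxE; congr (_ + _ * (_ - _ * _)).
  by apply: eq_bigr => i _; rewrite mxE.
split=> [[xE pE]|E]; last by rewrite -E in sysP.
case: (PhiSplit _ _ _) sysP => X P /= [XE PE].
suff xX : x' = X by rewrite pE PE xX.
have xXa n (a : 'I_N) : (a < n)%N -> x' a 0 = X a 0.
  elim: n a => // n IHn a an.
  rewrite xE XE; congr (_ + _ * (_ - _ * _)).
  apply: eq_bigr => i ia; congr (partial _ _ _); apply/colP => b.
  rewrite !xhatE; case: leqP => // bi; apply: IHn.
  by rewrite (leq_ltn_trans bi) // (leq_trans ia).
by apply/colP => a; apply: (xXa a.+1).
Qed.

Lemma generates_L1st (h : R) : h != 0 ->
  generates (L1st phis) h (PhiSplit phis h).
Proof.
by move=> h0 x p x' p'; rewrite legendre_L1stE // momentum_system_PhiSplit.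
Qed.

End SplitLagrangian.

Theorem theorem3p4 (R : realType) (N : nat)
    (phi : 'cV[R]_N -> R) (phis : 'I_N -> 'cV[R]_N -> R)
    (phis_smooth : forall i, smooth (phis i))
    (phi_split : forall x, phi x = \sum_(i < N) phis i x)
    (h : R) (h_neq0 : h != 0) :
  [/\ VI_equivalent (Ladj (L1st phis)) h (adjoint (PhiSplit phis) h),
      VI2_equivalent (two_stage (L1st phis) (Ladj (L1st phis))) h
        (adjoint (PhiSplit phis) (h / 2) \o PhiSplit phis (h / 2)) &
      VI2_equivalent (two_stage (Ladj (L1st phis)) (L1st phis)) h
        (PhiSplit phis (h / 2) \o adjoint (PhiSplit phis) (h / 2))].
Proof.
have genL k : k != 0 -> generates (L1st phis) k (PhiSplit phis k).
  exact: generates_L1st.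
have genLadj k : k != 0 ->
    generates (Ladj (L1st phis)) k (adjoint (PhiSplit phis) k).
  move=> k0; apply: generates_adjoint; first exact: PhiSplit_bij.
  by apply: genL; rewrite oppr_eq0.
have dL k : partially_derivable (L1st phis) k.
  move=> x x' a; split.
    by case: (is_derive_L1st_start phis phis_smooth x x' k a).
  by case: (is_derive_L1st_end phis phis_smooth x x' k a).
have dLadj k : partially_derivable (Ladj (L1st phis)) k.
  by move=> x x' a; have [] := dL (- k) x' x a.
have h2_neq0 : h / 2 != 0 by rewrite mulf_neq0 ?invr_eq0 ?pnatr_eq0.
split.
- exact/generates_VI/genLadj.
- by apply: generates_VI2 => //; apply: generates_two_stage; auto.
- by apply: generates_VI2 => //; apply: generates_two_stage; auto.
Qed.
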